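(* Let $S=\mathbb{C}[x_1,\ldots,x_n]$ and let $X=X_1\cup\ldots\cup X_s$ be an equidimensional subspace arrangement of codimension $k$ in $\mathbb{C}^n$ such that for all $i\in\{1,\ldots,s\}$, $X_i$ is a vector subspace (of codimension $k$) defined by the regular sequence $(h_{i,1},\ldots,h_{i,k})$ in $S$. If $s\leqslant\binom{n}{k}$ and $X$ is a generic subspace arrangement, then there exists a basis $\left(\delta_1,\ldots,\delta_{\binom{n}{k}}\right)$ of the free $S$-module $\bigwedge^k\mathrm{Der}_{\mathbb{C}^n}$ such that a minimal generating set of the $S$-module $\mathrm{Der}^k(-\log X)$ is given by $$\{h_{i,j}\delta_i \mid i\in\{1,\ldots,s\},\ j\in\{1,\ldots,k\}\}\cup\left\{\delta_i \mid s+1\leqslant i\leqslant \tbinom{n}{k}\right\}.$$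
   Context: Here $n\in\mathbb{N}_{\geqslant 1}$ and $S=\mathbb{C}[x_1,\ldots,x_n]$. $\mathrm{Der}_{\mathbb{C}^n}$ is the $S$-module of vector fields on $\mathbb{C}^n$, free of rank $n$ with basis $\partial_{x_1},\ldots,\partial_{x_n}$; $\Omega^q_{\mathbb{C}^n}$ is the $S$-module of differential $q$-forms; $\langle\cdot,\cdot\rangle:\bigwedge^q\mathrm{Der}_{\mathbb{C}^n}\times\Omega^q_{\mathbb{C}^n}\to S$ is the usual pairing. For an equidimensional subspace $X\subseteq\mathbb{C}^n$ of codimension $k$ defined as the vanishing set of the radical ideal $I_X\subseteq S$, the module of multi-logarithmic $k$-vector fields along $X$ is $$\mathrm{Der}^k(-\log X)=\left\{\delta\in\bigwedge^k\mathrm{Der}_{\mathbb{C}^n}\ \middle|\ \forall f_1,\ldots,f_k\in I_X,\ \langle\delta,df_1\wedge\dots\wedge df_k\rangle\in I_X\right\}.$$ An equidimensional subspace arrangement of codimension $k$ in $\mathbb{C}^n$ is a finite union of pairwise distinct vector subspaces of codimension $k$ of $\mathbb{C}^n$; $I_X$ denotes the radical ideal of polynomials vanishing on $X$. That the vector subspace $X_i$ is defined by $(h_{i,1},\ldots,h_{i,k})$ means $I_{X_i}=\langle h_{i,1},\ldots,h_{i,k}\rangle$. An element $\delta=\sum_{|E|=k}a_E\bigwedge_{i\in E}\partial_{x_i}$ (sum over subsets $E\subseteq\{1,\ldots,n\}$ of size $k$) of $\bigwedge^k\mathrm{Der}_{\mathbb{C}^n}$ is homogeneous of degree $p$ if all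 $a_E\in S$ are homogeneous polynomials of degree $p$; for a graded module $M$, $M_p$ denotes the set of its homogeneous elements of degree $p$. An equidimensional subspace arrangement $X=\bigcup_{i\in\Lambda}X_i$ of codimension $k$ in $\mathbb{C}^n$ ($\Lambda$ finite) is called generic if for $j=\min\{|\Lambda|,\binom{n}{k}\}$ and all $I\subseteq\Lambda$ with $|I|=j$, $$\dim_{\mathbb{C}}\left(\bigcap_{i\in I}\mathrm{Der}^k(-\log X_i)_0\right)=\binom{n}{k}-j.$$ *)

(* Defs.v *)
From HB Require Import structures.
From mathcomp Require Import all_boot all_order all_algebra.
From mathcomp Require Import complex classical_sets reals.
From mathcomp Require Import mpoly.

Set Implicit Arguments.
Unset Strict Implicit.
Unset Printing Implicit Defensive.

Import GRing.Theory.
Local Open Scope classical_set_scope.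
Local Open Scope ring_scope.

Section Modules.
Variables (A : comNzRingType) (V : lmodType A).

Definition mspan (G : set V) : set V :=
  [set v | exists m (c : 'I_m -> A) (g : 'I_m -> V),
     (forall i, G (g i)) /\ v = \sum_(i < m) c i *: g i].

Definition lin_indep m (b : 'I_m -> V) : Prop :=
  forall c : 'I_m -> A, \sum_(i < m) c i *: b i = 0 -> forall i, c i = 0.

Definition is_basis (M : set V) m (b : 'I_m -> V) : Prop :=
  lin_indep b /\ mspan (range b) = M.

Definition has_dim (M : set V) (d : nat) : Prop :=
  exists b : 'I_d -> V, is_basis M b.

Definition min_generating (M G : set V) : Prop :=
  mspan G = M /\ forall G' : set V, G' `<=` G -> mspan G' = M -> G' = G.

End Modules.

Section Ideals.
Variable A : comNzRingType.

Definition ideal_gen (G : set A) : set A := @mspan A A^o G.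

Definition regular_seq k (h : 'I_k -> A) : Prop :=
  (forall (j : 'I_k) (f : A),
     ideal_gen [set h i | i in [set i : 'I_k | (i < j)%N]] (f * h j) ->
     ideal_gen [set h i | i in [set i : 'I_k | (i < j)%N]] f) /\
  ~ ideal_gen (range h) 1.

End Ideals.

Section MultiVectorFields.
Variables (F : fieldType) (n : nat).
Local Notation S := {mpoly F[n]}.

Definition ksub (k : nat) := {E : {set 'I_n} | #|E| == k}.

(* The i-th smallest element of E: [enum] lists 'I_n in increasing order. *)
Definition ksub_nth k (E : ksub k) (i : 'I_k) : 'I_n :=
  enum_val (cast_ord (esym (eqP (valP E))) i).

(* The k-th exterior power of the module of vector fields, resp. the module of
   differential k-forms, as the free S-module on the wedges (in increasing
   order of the indices) of the d/dx_i, resp. of the dx_i, for i in E. *)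
Definition kvec (k : nat) := {ffun ksub k -> S^o}.
Definition kform (k : nat) := {ffun ksub k -> S^o}.

(* df_1 /\ ... /\ df_k: the coefficient on dx_E is a minor of the Jacobian. *)
Definition wedge_d k (f : 'I_k -> S) : kform k :=
  [ffun E : ksub k => \det (\matrix_(i, j) mderiv (ksub_nth E j) (f i))].

Definition pairing k (delta : kvec k) (omega : kform k) : S :=
  \sum_(E : ksub k) (delta E : S) * (omega E : S).

Definition vanishing_ideal (X : set 'rV[F]_n) : set S :=
  [set f | forall v, X v -> f.@[fun i => v 0 i] = 0].

Definition Der_log (k : nat) (X : set 'rV[F]_n) : set (kvec k) :=
  [set delta | forall f : 'I_k -> S, (forall i, vanishing_ideal X (f i)) ->
     vanishing_ideal X (pairing delta (wedge_d f))].

Definition kvec_homog (k p : nat) : set (kvec k) :=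
  [set delta | forall E, (delta E : S) \is p.-homog].

Arguments Der_log k X _ : clear implicits.
Arguments kvec_homog k p _ : clear implicits.

Definition graded_part k (M : set (kvec k)) (p : nat) : set (kvec k) :=
  M `&` kvec_homog k p.

(* Dimension over the base field F: dropping the ^o on the coefficients selects
   the F-vector space structure instead of the S-module structure. *)
Definition has_dimF k (M : set (kvec k)) (d : nat) : Prop :=
  @has_dim F {ffun ksub k -> S} M d.

Definition subspace_arrangement (k : nat) (L : finType)
    (X : L -> {vspace 'rV[F]_n}) : Prop :=
  injective X /\ forall i, (\dim (X i) + k = n)%N.

Definition arr_union (L : finType) (X : L -> {vspace 'rV[F]_n}) :
  set 'rV[F]_n := \bigcup_(i in [set: L]) [set` X i].

(* The factor [kvec_homog k 0] only matters when I is empty: the intersection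
   is taken inside the degree 0 part of [kvec k]. *)
Definition generic (k : nat) (L : finType)
    (X : L -> {vspace 'rV[F]_n}) : Prop :=
  forall I : {set L}, #|I| = minn #|L| 'C(n, k) ->
    has_dimF (kvec_homog k 0 `&`
              \bigcap_(i in [set` I]) graded_part (Der_log k [set` X i]) 0)
             ('C(n, k) - #|I|).

End MultiVectorFields.

Arguments Der_log {F n} k X _.
Arguments kvec_homog {F n} k p _.
Arguments generic {F n} k {L} X.
Arguments subspace_arrangement {F n} k {L} X.

(* Main.v *)
Require Import Defs.
From HB Require Import structures.
From mathcomp Require Import all_boot all_order all_algebra.
From mathcomp Require Import complex classical_sets reals.
From mathcomp Require Import mpoly.

Local Open Scope classical_set_scope.
Local Open Scope ring_scope.

Import GRing.Theory Num.Theory.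
Set Implicit Arguments.
Unset Strict Implicit.
Unset Printing Implicit Defensive.

(** Let [X i] be the kernel of a matrix [A i] of rank [k], and let [w i] be the
    constant [k]-form that is the wedge product of its [k] linear equations; the
    coefficients of [w i] are the maximal minors of [A i].

    A multivector field [d] is logarithmic along [X i] if and only if its
    contraction with [w i] vanishes on [X i]: along [X i] the gradient of a
    function vanishing there is a combination of the equations
    ([gradient_vanishing]), so [df_1 /\ ... /\ df_k] is there a multiple of
    [w i] ([eval_pairing]). It is logarithmic along the union if and only if this
    holds for every [i] ([Der_log_arrangement]): multiply the equations of [X i]
    by a polynomial [g] that vanishes on the other components but not on [X i];
    this multiplies the contraction by [g ^+ k] along [X i], and the ideal of
    [X i] is prime.

    In degree zero, being logarithmic along [X i] means being killed by [w i].
    Genericity therefore says that [w 0, ..., w (s-1)] are linearly independent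
    ([generic_minors_full]). Complete them to a basis of the constant [k]-forms
    and take [delta] to be the dual basis ([pid_completion]). In the coordinates
    given by [delta], a field is logarithmic along the arrangement if and only if
    its [i]-th coordinate lies in the ideal of [X i] for all [i < s], which gives
    the generating set.

    The generating set is minimal coordinate by coordinate. For [i >= s] this is
    clear. For [i < s], the ideal of [X i] cannot be generated by [k - 1] of the
    [h i j], because the gradients at the origin of its elements span a space of
    dimension [k] ([subspace_ideal_minimal]). *)

(** * Linear algebra *)

Section Span.
Variables (A : comNzRingType) (V : lmodType A).
Implicit Types (G M : set V) (u v : V).

Lemma mspan_gen G v : G v -> mspan G v.
Proof.
move=> Gv; exists 1%N, (fun=> 1), (fun=> v); split=> //.
by rewrite big_ord1 scale1r.
Qed.

Lemma mspanZ G a v : mspan G v -> mspan G (a *: v).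
Proof.
move=> [m [c [g [Gg ->]]]]; exists m, (fun i => a * c i), g; split=> //.
by rewrite scaler_sumr; apply: eq_bigr => i _; rewrite scalerA.
Qed.

Lemma mspan0 G : mspan G 0.
Proof.
by exists 0%N, (fun=> 0), (fun=> 0); split=> [[]|] //; rewrite big_ord0.
Qed.

Lemma mspanD G u v : mspan G u -> mspan G v -> mspan G (u + v).
Proof.
move=> [m [c [g [Gg ->]]]] [p [d [e [Ge ->]]]].
(* Concatenation of two families. *)
pose sel T (x : 'I_m -> T) (y : 'I_p -> T) (i : 'I_(m + p)) :=
  match split i with inl a => x a | inr b => y b end.
have sell T x y a : @sel T x y (lshift p a) = x a.
  by rewrite /sel -[lshift p a]/(unsplit (inl a)) unsplitK.
have selr T x y b : @sel T x y (rshift m b) = y b.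
  by rewrite /sel -[rshift m b]/(unsplit (inr b)) unsplitK.
exists (m + p)%N, (sel _ c d), (sel _ g e); split.
  by move=> i; rewrite /sel; case: (split i).
rewrite big_split_ord /=; congr (_ + _); apply: eq_bigr => i _;
  by rewrite ?sell ?selr.
Qed.

Lemma mspan_sum G m (f : 'I_m -> V) :
  (forall i, mspan G (f i)) -> mspan G (\sum_i f i).
Proof.
move=> Gf; apply: (big_ind (mspan G)) => //; first exact: mspan0.
by move=> *; apply: mspanD.
Qed.

(** The span of [G] is contained in every submodule that contains [G]. *)
Lemma mspan_min G M : M 0 -> (forall u v, M u -> M v -> M (u + v)) ->
  (forall a v, M v -> M (a *: v)) -> G `<=` M -> mspan G `<=` M.
Proof.
move=> M0 MD MZ GM v [m [c [g [Gg ->]]]].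
by apply: (big_ind M) => // i _; apply/MZ/GM/Gg.
Qed.

End Span.

Lemma ideal_genD (A : comNzRingType) (G : set A) f g :
  ideal_gen G f -> ideal_gen G g -> ideal_gen G (f + g).
Proof. exact: (@mspanD A A^o). Qed.

Lemma ideal_genM (A : comNzRingType) (G : set A) a f :
  ideal_gen G f -> ideal_gen G (a * f).
Proof. exact: (@mspanZ A A^o). Qed.

Section Matrices.
Variable F : fieldType.

(** A subspace of codimension [k] is the kernel of an [n * k] matrix of rank
    [k]: the columns of the matrix are independent linear equations. *)
Lemma vspace_equations n k (U : {vspace 'rV[F]_n}) : (\dim U + k = n)%N ->
  exists2 A : 'M[F]_(n, k), row_full A & forall v, (v \in U) = (v *m A == 0).
Proof.
move=> dimU; set B : 'M[F]_(\dim U, n) := \matrix_i (vbasis U)`_i.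
have rkB : \rank B = \dim U.
  apply/eqP; rewrite -/(row_free B); apply: inj_row_free => c cB.
  have /freeP fr := basis_free (vbasisP U).
  apply/rowP => i; rewrite mxE; apply: (fr (fun i => c 0 i)).
  rewrite -[RHS]cB mulmx_sum_row; apply: eq_bigr => j _.
  by rewrite rowK.
have UB v : (v \in U) = (v <= B)%MS.
  apply/idP/submxP => [/coord_vbasis -> | [c ->]].
    exists (\row_i coord (vbasis U) i v); rewrite mulmx_sum_row.
    by apply: eq_bigr => j _; rewrite rowK mxE.
  rewrite mulmx_sum_row memv_suml // => i _; rewrite rowK.
  by rewrite rpredZ // vbasis_mem // mem_nth // size_tuple.
have rkC : \rank (cokermx B) = k.
  rewrite mxrank_coker rkB; apply/eqP; rewrite -(eqn_add2l (\dim U)) dimU.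
  by rewrite subnKC // -rkB rank_leq_col.
have kerC v : (v \in U) = (v *m col_base (cokermx B) == 0).
  rewrite UB submxE -{1}[cokermx B]mulmx_base mulmxA.
  by rewrite mulmx_free_eq0 // row_base_free.
have := col_base_full (cokermx B).
move: (col_base _) kerC; rewrite rkC => A kerA fullA.
by exists A.
Qed.

(** A matrix of full column rank is the beginning of an invertible matrix, whose
    inverse [D] transforms it into the first columns of the identity. *)
Lemma pid_completion N s (W : 'M[F]_(N, s)) : row_full W ->
  exists2 D : 'M[F]_N, D \in unitmx & D *m W = pid_mx s.
Proof.
rewrite /row_full => /eqP rkW; have sN : (s <= N)%N by rewrite -rkW rank_leq_row.
have [m eN] : exists m, N = (s + m)%N by exists (N - s)%N; rewrite subnKC.
subst N; have eW := mulmx_ebase W; rewrite rkW in eW.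
have Ru := row_ebase_unit W; have Lu := col_ebase_unit W.
exists (block_mx (invmx (row_ebase W)) 0 0 1%:M *m invmx (col_ebase W)).
  rewrite unitmx_mul unitmx_inv Lu andbT unitmxE det_ublock det1 mulr1.
  by rewrite -unitmxE unitmx_inv.
rewrite -{3}eW -!mulmxA mulKmx // mulmxA pid_mx_col mul_block_col.
by rewrite !mul0mx !mulmx0 mulmx1 !addr0 mul_col_mx mulVmx // mul0mx.
Qed.

End Matrices.

(** * Vanishing ideals of subspaces *)

Section Polynomials.
Variables (F : numFieldType) (n : nat).
Local Notation S := {mpoly F[n]}.
Implicit Types (f g : S) (u v w : 'rV[F]_n) (X : set 'rV[F]_n).

(** The value of a polynomial at a row vector. *)
Definition evalv v f : F := f.@[fun i => v 0 i].

(** The gradient at a point, as a column of partial derivatives. *)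
Definition gradient v f : 'cV[F]_n := \col_i evalv v (mderiv i f).

(** The restriction of [f] to the line through [v] with direction [w]. *)
Definition line_poly v w f : {poly F} :=
  mmap polyC (fun i => (v 0 i)%:P + w 0 i *: 'X) f.

Lemma evalvM v f g : evalv v (f * g) = evalv v f * evalv v g.
Proof. exact: mevalM. Qed.

Lemma line_polyM v w f g :
  line_poly v w (f * g) = line_poly v w f * line_poly v w g.
Proof. exact: rmorphM. Qed.

Lemma line_polyD v w f g :
  line_poly v w (f + g) = line_poly v w f + line_poly v w g.
Proof. exact: rmorphD. Qed.

Lemma line_polyC v w c : line_poly v w c%:MP = c%:P.
Proof. exact: mmapC. Qed.

Lemma line_polyX v w i : line_poly v w 'X_i = (v 0 i)%:P + w 0 i *: 'X.
Proof. by rewrite /line_poly mmapX mmap1U. Qed.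

Lemma horner_line v w f t : (line_poly v w f).[t] = evalv (v + t *: w) f.
Proof.
rewrite /line_poly /evalv mevalE horner_sum; apply: eq_bigr => m _.
rewrite hornerM hornerC; congr (_ * _); rewrite horner_prod.
by apply: eq_bigr => i _; rewrite !hornerE !mxE [w 0 i * t]mulrC.
Qed.

(** The polynomials are generated, as a ring, by constants and variables. *)
Lemma mpoly_ring_ind (P : S -> Prop) :
  (forall c, P c%:MP) -> (forall i, P 'X_i) ->
  (forall f g, P f -> P g -> P (f + g)) ->
  (forall f g, P f -> P g -> P (f * g)) -> forall f, P f.
Proof.
move=> PC PX PD PM; apply: mpolyind => [|c m p _ _ Pp]; first by rewrite -mpolyC0.
apply: PD => //; rewrite -mul_mpolyC; apply: (PM) => //; rewrite mpolyXE_id.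
have P1 : P 1 by rewrite -mpolyC1.
apply: (big_ind P) => // i _; elim: (m i) => [|e Pe]; first by rewrite expr0.
by rewrite exprS; apply: PM.
Qed.

Lemma mderivXU (i j : 'I_n) : mderiv i 'X_j = ((i == j)%:R)%:MP :> S.
Proof.
rewrite mderivX mnm1E eq_sym; case: eqVneq => [->|_]; last first.
  by rewrite scale0r mpolyC0.
rewrite scale1r (_ : (U_(j) - U_(j))%MM = 0%MM) ?mpolyX0 ?mpolyC1 //.
by apply/mnmP => l; rewrite mnmBE subnn mnm0E.
Qed.

Lemma deriv_line v w f :
  (line_poly v w f)^`() = \sum_i w 0 i *: line_poly v w (mderiv i f).
Proof.
elim/mpoly_ring_ind: f => [c|j|f g IHf IHg|f g IHf IHg].
- rewrite line_polyC derivC big1 // => i _; rewrite mderivC.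
  by rewrite /line_poly mmap0 scaler0.
- rewrite line_polyX derivD derivC derivZ derivX add0r (bigD1 j) //= big1.
    by rewrite addr0 mderivXU eqxx line_polyC.
  by move=> i ij; rewrite mderivXU (negPf ij) line_polyC scaler0.
- rewrite line_polyD derivD IHf IHg -big_split; apply: eq_bigr => i _ /=.
  by rewrite mderivD line_polyD scalerDr.
- rewrite line_polyM derivM IHf IHg mulr_suml mulr_sumr -big_split.
  apply: eq_bigr => i _ /=.
  by rewrite mderivM line_polyD !line_polyM scalerDr scalerAl scalerAr.
Qed.

Lemma poly_eq0_horner (p : {poly F}) : (forall t, p.[t] = 0) -> p = 0.
Proof.
move=> p0; apply/eqP; apply: contraT => /max_poly_roots.
move=> /(_ [seq i%:R | i <- iota 0 (size p)]); rewrite size_map size_iota ltnn.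
apply; last by rewrite map_inj_uniq ?iota_uniq //; apply: mulrIn; rewrite oner_eq0.
by apply/allP => x _; rewrite /root p0.
Qed.

(** The hypothesis on [X] says that [X] is an affine subspace, hence
    irreducible: the restrictions of [f] and [g] to the line joining a point of
    [X] where [g] does not vanish to any other point have product zero. *)
Lemma vanishing_ideal_prime X f g :
    (forall v w t, X v -> X w -> X (v + t *: (w - v))) ->
  vanishing_ideal X (g * f) -> ~ vanishing_ideal X g -> vanishing_ideal X f.
Proof.
move=> aff gf0 ng v Xv; apply/eqP; apply: contraT => fv; case: ng => w Xw.
have /poly_eq0_horner/eqP : forall t, (line_poly v (w - v) (g * f)).[t] = 0.
  by move=> t; rewrite horner_line; apply/gf0/aff.
rewrite line_polyM mulf_eq0 => /orP[] /eqP L0.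
  have := horner_line v (w - v) g 1.
  by rewrite L0 horner0 scale1r subrKC => /esym.
have := horner_line v (w - v) f 0.
by rewrite L0 horner0 scale0r addr0 => /esym/eqP; rewrite /evalv (negPf fv).
Qed.

Lemma vanishing_idealM X f g : vanishing_ideal X f -> vanishing_ideal X (g * f).
Proof. by move=> f0 v Xv; rewrite mevalM f0 // mulr0. Qed.

Lemma vanishing_ideal0 X : vanishing_ideal X (0 : S).
Proof. by move=> v Xv; rewrite meval0. Qed.

Lemma gradientM v f g :
  gradient v (f * g) = evalv v g *: gradient v f + evalv v f *: gradient v g.
Proof.
apply/colP => i; rewrite !mxE mderivM /evalv mevalD !mevalM.
by rewrite [_ * g.@[_]]mulrC.
Qed.

Section LinearSubspace.
Variables (k : nat) (A : 'M[F]_(n, k)).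

(** The linear subspace cut out by the columns of [A]. *)
Definition kerset : set 'rV[F]_n := [set v | v *m A = 0].

(** The linear form given by column [b] of [A]. *)
Definition linform (b : 'I_k) : S := \sum_i A i b *: 'X_i.

Lemma kerset_affine v w t :
  kerset v -> kerset w -> kerset (v + t *: (w - v)).
Proof.
rewrite /kerset /= => v0 w0.
by rewrite mulmxDl -scalemxAl mulmxBl v0 w0 subrr scaler0 addr0.
Qed.

Lemma kerset0 : kerset 0.
Proof. exact: mul0mx. Qed.

Lemma evalv_linform v b : evalv v (linform b) = (v *m A) 0 b.
Proof.
rewrite /evalv /linform raddf_sum mxE /=; apply: eq_bigr => i _.
by rewrite mevalZ mevalXU mulrC.
Qed.

Lemma linform_vanishing b : vanishing_ideal kerset (linform b).
Proof. by move=> v v0; rewrite -/(evalv v _) evalv_linform v0 mxE. Qed.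

Lemma gradient_linform v b : gradient v (linform b) = col b A.
Proof.
apply/colP => i; rewrite !mxE /linform raddf_sum /=.
rewrite /evalv raddf_sum (bigD1 i) //= big1 => [|j ji].
  by rewrite addr0 mderivZ mderivXU eqxx mevalZ mevalC mulr1.
by rewrite mderivZ mderivXU eq_sym (negPf ji) mevalZ mevalC mulr0.
Qed.

(** Along a linear subspace, the gradient of a polynomial of its ideal is a
    combination of the equations. Indeed it kills the directions of the
    subspace. *)
Lemma gradient_vanishing f v : row_full A -> kerset v ->
  vanishing_ideal kerset f -> exists c : 'cV[F]_k, gradient v f = A *m c.
Proof.
move=> /row_fullP[Z ZA] Xv f0.
(* [f] vanishes on the line through [v] with direction [w]. *)
have kill w : kerset w -> w *m gradient v f = 0.
  move=> Xw; apply/rowP => j; rewrite ord1 !mxE.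
  have L0 : line_poly v w f = 0.
    apply: poly_eq0_horner => t; rewrite horner_line; apply: f0.
    by rewrite /kerset /= mulmxDl -scalemxAl Xv Xw scaler0 addr0.
  have := congr1 (horner^~ 0) (deriv_line v w f).
  rewrite L0 deriv0 horner0 horner_sum => L0'.
  rewrite [RHS]L0'; apply: eq_bigr => i _.
  by rewrite hornerZ horner_line scale0r addr0 mxE.
(* As [Z *m A = 1], the rows of [1 - A *m Z] lie in the kernel of [A]. *)
exists (Z *m gradient v f); apply/eqP; rewrite mulmxA -subr_eq0.
rewrite -{1}[gradient v f]mul1mx -mulmxBl; apply/eqP/row_matrixP => i.
rewrite row_mul kill ?row0 // /kerset /= -row_mul mulmxBl mul1mx -mulmxA ZA.
by rewrite mulmx1 subrr row0.
Qed.

End LinearSubspace.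
End Polynomials.

(** * Multi-logarithmic vector fields along linear subspaces *)

Section MultiVectors.
Variables (F : numFieldType) (n k : nat).
Local Notation S := {mpoly F[n]}.
Local Notation N := ('C(n, k)).
Implicit Types (A : 'M[F]_(n, k)) (w : ksub n k -> F) (d : kvec F n k).

(** The contraction of a multivector field with a constant form [w]. *)
Definition contract w d : S := \sum_E (d E : S) * (w E)%:MP.

(** The constant form that is the wedge product of the linear forms given by
    the columns of [A]: its coefficients are the maximal minors of [A]. *)
Definition minors A (E : ksub n k) : F :=
  \det (\matrix_(i, j) A (ksub_nth E j) i).

Lemma contract0 w : contract w 0 = 0.
Proof. by rewrite /contract big1 // => E _; rewrite ffunE mul0r. Qed.

Lemma contractD w d1 d2 : contract w (d1 + d2) = contract w d1 + contract w d2.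
Proof.
rewrite /contract -big_split; apply: eq_bigr => E _ /=.
by rewrite ffunE mulrDl.
Qed.

Lemma contractZ w (a : S) d : contract w (a *: d) = a * contract w d.
Proof.
rewrite /contract mulr_sumr; apply: eq_bigr => E _.
by rewrite ffunE mulrA.
Qed.

Lemma contract_sum w m (u : 'I_m -> kvec F n k) :
  contract w (\sum_i u i) = \sum_i contract w (u i).
Proof. exact: (big_morph _ (contractD w) (contract0 w)). Qed.

(** When the gradients of the [f i] at [v] are combinations of the columns of
    [A], the form [df_1 /\ ... /\ df_k] at [v] is a multiple of that of [A]. *)
Lemma eval_pairing A (C : 'M[F]_k) d (f : 'I_k -> S) v :
    (forall i, gradient v (f i) = A *m col i C) ->
  evalv v (pairing d (wedge_d f)) = \det C * evalv v (contract (minors A) d).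
Proof.
move=> gf; rewrite /evalv /pairing /contract !raddf_sum mulr_sumr.
apply: eq_bigr => E _ /=; rewrite !mevalM mevalC mulrCA; congr (_ * _).
rewrite ffunE -det_map_mx -[\det C]det_tr /minors -det_mulmx; congr (\det _).
apply/matrixP => i j; rewrite !mxE.
have /(congr1 (fun M : 'cV_n => M (ksub_nth E j) 0)) := gf i.
rewrite !mxE => e; apply: etrans e _; apply: eq_bigr => b _.
by rewrite !mxE mulrC.
Qed.

Lemma contract_Der_log A d (f : 'I_k -> S) : row_full A ->
    vanishing_ideal (kerset A) (contract (minors A) d) ->
    (forall i, vanishing_ideal (kerset A) (f i)) ->
  vanishing_ideal (kerset A) (pairing d (wedge_d f)).
Proof.
move=> Afull d0 f0 v Xv.
have /fin_all_exists[c gc] i := gradient_vanishing Afull Xv (f0 i).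
pose C := \matrix_(b, i) c i b 0.
have colC i : col i C = c i by apply/colP => b; rewrite !mxE.
rewrite -/(evalv v _) (@eval_pairing A C).
  by rewrite /evalv d0 ?mulr0.
by move=> i; rewrite colC.
Qed.

(** Testing [d] on the functions [g * linform A b], which vanish on [Y] and
    coincide up to the factor [g] with the equations of one component. *)
Lemma Der_log_contract A d Y (g : S) : kerset A `<=` Y ->
    ~ vanishing_ideal (kerset A) g ->
    (forall b, vanishing_ideal Y (g * linform A b)) ->
  Der_log k Y d -> vanishing_ideal (kerset A) (contract (minors A) d).
Proof.
move=> AY g0 gY dY.
apply: (@vanishing_ideal_prime _ _ _ _ (g ^+ k)).
- by move=> v w t; apply: kerset_affine.
- move=> v Xv; have := dY _ gY v (AY _ Xv); rewrite -!/(evalv v _).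
  rewrite (@eval_pairing A (evalv v g)%:M); last first.
    move=> b; rewrite gradientM gradient_linform evalv_linform Xv mxE scale0r add0r.
    apply/colP => i; rewrite !mxE (bigD1 b) //= big1.
      by rewrite !mxE eqxx mulr1n addr0 mulrC.
    by move=> j jb; rewrite !mxE (negPf jb) mulr0n mulr0.
  by rewrite det_scalar evalvM /evalv rmorphXn.
- move=> gk0; apply: g0 => v Xv; have := gk0 v Xv; rewrite rmorphXn /=.
  by move/eqP; rewrite expf_eq0 => /andP[_ /eqP].
Qed.

Section Arrangement.
Variables (L : finType) (A : L -> 'M[F]_(n, k)).
Hypothesis Afull : forall i, row_full (A i).
Hypothesis Asep : forall i j, i != j ->
  exists2 w, kerset (A i) w & ~ kerset (A j) w.

(** Some polynomial vanishes on all components but one: a product of linear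
    forms. *)
Lemma separating_poly i : exists2 g : S, ~ vanishing_ideal (kerset (A i)) g &
  forall j, i != j -> vanishing_ideal (kerset (A j)) g.
Proof.
suff [g g1 g2] : exists2 g : S, ~ vanishing_ideal (kerset (A i)) g &
    forall j, j \in enum L -> i != j -> vanishing_ideal (kerset (A j)) g.
  by exists g => // j; apply: g2; rewrite mem_enum.
elim: (enum L) => [|j r [g g1 g2]].
  exists 1 => // /(_ 0 (kerset0 _)); rewrite meval1; apply/eqP; exact: oner_neq0.
case: (eqVneq i j) => [<-|ij].
  by exists g => // l; rewrite inE => /predU1P[->|/g2//]; rewrite eqxx.
have [w Xw nXw] := Asep ij.
have [b wb] : exists b, (w *m A j) 0 b != 0.
  by apply/rV0Pn; apply/eqP.
exists (linform (A j) b * g) => [lg0|l].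
  apply: g1; apply: vanishing_ideal_prime lg0 _ => [v u t|l0].
    exact: kerset_affine.
  by have := l0 w Xw; rewrite -/(evalv w _) evalv_linform => /eqP; apply/negP.
rewrite inE => /predU1P[-> _|/g2 gl /gl]; last exact: vanishing_idealM.
by rewrite mulrC; apply/vanishing_idealM/linform_vanishing.
Qed.

Lemma Der_log_arrangement d :
  Der_log k (\bigcup_(i in [set: L]) kerset (A i)) d <->
  forall i, vanishing_ideal (kerset (A i)) (contract (minors (A i)) d).
Proof.
split=> [dX i | dX f f0 v [i _ Xv]]; last first.
  by apply: (@contract_Der_log (A i)) Xv => // j u Xu; apply: f0; exists i.
have [g g1 g2] := separating_poly i.
apply: Der_log_contract g1 _ dX => [v Xv|b v [j _ Xv]]; first by exists i.
rewrite mevalM; case: (eqVneq i j) => [ij|/g2 ->//]; last by rewrite mul0r.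
by rewrite (linform_vanishing b) ?mulr0 // ij.
Qed.

End Arrangement.

(** * Constant frames *)

Lemma card_ksub : #|{: ksub n k}| = N.
Proof.
rewrite card_sig -[in RHS](card_ord n) -card_draws cardsE.
by apply: eq_card => E; rewrite !inE.
Qed.

(** A numbering of the [k]-subsets, used to treat constant forms and
    multivector fields as column and row vectors. *)
Definition ksub_rank (E : ksub n k) : 'I_N := cast_ord card_ksub (enum_rank E).
Definition ksub_val (e : 'I_N) : ksub n k :=
  enum_val (cast_ord (esym card_ksub) e).

Lemma ksub_rankK : cancel ksub_rank ksub_val.
Proof. by move=> E; rewrite /ksub_val cast_ordK enum_rankK. Qed.

Lemma ksub_valK : cancel ksub_val ksub_rank.
Proof. by move=> E; rewrite /ksub_rank enum_valK cast_ordKV. Qed.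

Lemma ksub_val_bij : {on [pred _ | true], bijective ksub_val}.
Proof. by exists ksub_rank => ? _; rewrite (ksub_valK, ksub_rankK). Qed.

(** The multivector field with constant coefficients [c]. *)
Definition const_kvec (c : 'rV[F]_N) : kvec F n k :=
  [ffun E => (c 0 (ksub_rank E))%:MP].

Lemma contract_const w c :
  contract w (const_kvec c) = ((c *m \col_e w (ksub_val e)) 0 0)%:MP.
Proof.
rewrite /contract mxE raddf_sum (reindex _ ksub_val_bij) /=.
by apply: eq_bigr => e _; rewrite ffunE ksub_valK mxE -mpolyCM.
Qed.

(** The constant terms of the coefficients of a multivector field. Dropping the
    regular-module annotation on [S] selects the structure of vector space over
    [F], for which this map is linear. *)
Definition kvec_const (d : {ffun ksub n k -> S}) : 'rV[F]_N :=
  \row_e (d (ksub_val e))@_0%MM.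

Lemma const_kvecK : cancel const_kvec kvec_const.
Proof.
move=> c; apply/rowP => e.
by rewrite !mxE ffunE ksub_valK mcoeffC eqxx mulr1.
Qed.

Section Frame.
Variable D : 'M[F]_N.
Hypothesis Du : D \in unitmx.

(** The frame of constant multivector fields given by the rows of [D], and the
    coordinates in this frame. *)
Definition frame (i : 'I_N) : kvec F n k := const_kvec (row i D).
Definition frame_coord (i : 'I_N) : kvec F n k -> S :=
  contract (fun E => invmx D (ksub_rank E) i).

Lemma frame_coordE i j : frame_coord i (frame j) = (j == i)%:R.
Proof.
rewrite /frame_coord contract_const.
have /(congr1 (fun M : 'M_N => M j i)) := mulmxV Du; rewrite [RHS]mxE => DD.
rewrite -mpolyC_nat -DD !mxE; congr (_%:MP); apply: eq_bigr => e _.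
by rewrite !mxE ksub_valK.
Qed.

Lemma frame_sum d : d = \sum_i frame_coord i d *: frame i.
Proof.
apply/ffunP => E; rewrite sum_ffunE.
transitivity (\sum_i \sum_E' (d E' : S) *
    (invmx D (ksub_rank E') i * D i (ksub_rank E))%:MP : S); last first.
  apply: eq_bigr => i _; rewrite !ffunE /frame_coord /contract /GRing.scale /=.
  by rewrite mulr_suml; apply: eq_bigr => E' _; rewrite !mxE mpolyCM mulrA.
rewrite exchange_big /= (bigD1 E) //= [X in _ + X]big1 ?addr0 => [|E' neE].
  rewrite -mulr_sumr -raddf_sum /=.
  have /(congr1 (fun M : 'M_N => M (ksub_rank E) (ksub_rank E))) := mulVmx Du.
  by rewrite !mxE eqxx => ->; rewrite mpolyC1 mulr1.
rewrite -mulr_sumr -raddf_sum /=.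
have /(congr1 (fun M : 'M_N => M (ksub_rank E') (ksub_rank E))) := mulVmx Du.
by rewrite !mxE (can_eq ksub_rankK) (negPf neE) => ->; rewrite mpolyC0 mulr0.
Qed.

Lemma frame_basis : is_basis [set: kvec F n k] frame.
Proof.
split=> [c c0 i|].
  have := congr1 (frame_coord i) c0; rewrite /frame_coord contract0 contract_sum.
  rewrite (bigD1 i) //= big1 => [|j ji].
    by rewrite contractZ -/(frame_coord i _) frame_coordE eqxx mulr1 addr0.
  by rewrite contractZ -/(frame_coord i _) frame_coordE (negPf ji) mulr0.
apply/seteqP; split=> // d _; rewrite (frame_sum d); apply: mspan_sum => i.
by apply/mspanZ/mspan_gen; exists i.
Qed.

End Frame.

End MultiVectors.

(** * Genericity and minimality *)

Section Main.
Variables (F : numFieldType) (n k : nat).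
Local Notation S := {mpoly F[n]}.
Local Notation N := ('C(n, k)).

(** If a space of multivector fields contains all constant ones killed by the
    forms [W] and has dimension [p], then [W] has rank at least [N - p]. *)
Lemma rank_ge_codim s (W : 'M[F]_(N, s)) (M : set (kvec F n k)) p :
    (forall c : 'rV_N, c *m W = 0 -> M (const_kvec c)) -> has_dimF M p ->
  (N - p <= \rank W)%N.
Proof.
move=> WM [b [_ defM]]; pose B := \matrix_i kvec_const (b i).
suff kerB : (kermx W <= B)%MS.
  have := leq_trans (mxrankS kerB) (rank_leq_row B).
  by rewrite mxrank_ker leq_subCl.
apply/row_subP => i; set c := row i _.
have /WM : c *m W = 0 by rewrite -row_mul mulmx_ker row0.
rewrite -defM => Mc; rewrite -[c]const_kvecK.
pose T := [set d : {ffun ksub n k -> S} | (kvec_const d <= B)%MS].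
apply: (@mspan_min F {ffun ksub n k -> S} (range b) T) Mc; rewrite /T /=.
- rewrite (_ : kvec_const _ = 0) ?sub0mx //.
  by apply/rowP => e; rewrite !mxE ffunE mcoeff0.
- move=> u v Tu Tv; rewrite (_ : kvec_const _ = kvec_const u + kvec_const v).
    exact: addmx_sub.
  by apply/rowP => e; rewrite !mxE ffunE mcoeffD.
- move=> a v Tv; rewrite (_ : kvec_const _ = a *: kvec_const v) ?scalemx_sub //.
  by apply/rowP => e; rewrite !mxE ffunE mcoeffZ.
- by move=> _ [j _ <-]; rewrite /T /= -(rowK (fun i => kvec_const (b i))) row_sub.
Qed.

(** Genericity means that the constant forms attached to the components are
    linearly independent. *)
Lemma generic_minors_full s (X : 'I_s -> {vspace 'rV[F]_n})
    (A : 'I_s -> 'M[F]_(n, k)) : (s <= N)%N ->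
    (forall i, row_full (A i)) -> (forall i, [set` X i] = kerset (A i)) ->
  generic k X -> row_full (\matrix_(e, i) minors (A i) (ksub_val e)).
Proof.
move=> sN Afull XA /(_ (finset.setTfor 'I_s)).
rewrite cardsT card_ord (minn_idPl sN).
move=> /(_ erefl) dimM; rewrite /row_full eqn_leq rank_leq_col /=.
rewrite -{1}(subKn sN); apply: rank_ge_codim dimM => c cW.
have homc : kvec_homog k 0 (const_kvec c).
  by move=> E; rewrite ffunE -[_%:MP]mulr1 mul_mpolyC dhomogZ ?dhomog1.
split=> // i _; split=> // f; rewrite XA => f0.
apply: contract_Der_log f0 => //; rewrite contract_const.
have -> : \col_e minors (A i) (ksub_val e) =
          col i (\matrix_(e, i) minors (A i) (ksub_val e)).
  by apply/colP => e; rewrite !mxE.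
rewrite colE mulmxA cW mul0mx mxE mpolyC0; exact: vanishing_ideal0.
Qed.

(** The ideal of a subspace of codimension [k] needs [k] generators: if one is
    dropped, the gradients at the origin span too small a space. *)
Lemma subspace_ideal_minimal (A : 'M[F]_(n, k)) (h : 'I_k -> S) j (G : set S) :
    row_full A -> (forall i, vanishing_ideal (kerset A) (h i)) ->
    (forall f, G f -> f = 0 \/ exists2 i, i != j & f = h i) ->
  ~ vanishing_ideal (kerset A) `<=` ideal_gen G.
Proof.
move=> Afull h0 GH IG.
pose H := \matrix_i (if i == j then 0 else (gradient 0 (h i))^T).
pose T := [set f : S^o | evalv 0 f = 0 /\ ((gradient 0 (f : S))^T <= H)%MS].
have g0 : gradient 0 (0 : S) = 0.
  by apply/colP => i; rewrite !mxE raddf0 /evalv meval0.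
have IT : vanishing_ideal (kerset A) `<=` T.
  move=> f /IG; apply: mspan_min.
  - by split; [exact: meval0 | rewrite g0 trmx0 sub0mx].
  - move=> u v [u0 Tu] [v0 Tv]; split.
      by rewrite /evalv mevalD -!/(evalv 0 _) u0 v0 addr0.
    rewrite (_ : gradient 0 _ = gradient 0 (u : S) + gradient 0 (v : S)).
      by rewrite linearD /= addmx_sub.
    by apply/colP => i; rewrite !mxE raddfD /evalv mevalD.
  - move=> a v [v0 Tv]; split; first by rewrite /GRing.scale /= evalvM v0 mulr0.
    rewrite /GRing.scale /= gradientM v0 scale0r add0r linearZ /=.
    exact: scalemx_sub.
  - move=> g /GH[->|[i ij ->]].
      by split; [exact: meval0 | rewrite g0 trmx0 sub0mx].
    split; first exact: h0 (kerset0 A).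
    by have := row_sub i H; rewrite rowK (negPf ij).
have AH : (A^T <= H)%MS.
  apply/row_subP => b; rewrite -tr_col -(gradient_linform A 0 b).
  by have [] := IT _ (linform_vanishing (A := A) b).
have Hfree : row_free H.
  rewrite /row_free eqn_leq rank_leq_row /=; apply: leq_trans (mxrankS AH).
  by rewrite mxrank_tr; move: Afull => /eqP ->.
have := mulmx_free_eq0 (delta_mx 0 j : 'rV_k) Hfree.
rewrite -rowE rowK eqxx /= eqxx => /esym/eqP/rowP/(_ j)/eqP.
by rewrite !mxE !eqxx oner_eq0.
Qed.

(** The arrangement need not be complex: this holds over any numeric field. *)
Lemma generic_arrangement_generators s (X : 'I_s -> {vspace 'rV[F]_n})
    (h : 'I_s -> 'I_k -> S) (sN : (s <= N)%N) :
    subspace_arrangement k X ->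
    (forall i, vanishing_ideal [set` X i] = ideal_gen (range (h i))) ->
    generic k X ->
  exists delta : 'I_N -> kvec F n k,
    is_basis [set: kvec F n k] delta /\
    min_generating (Der_log k (arr_union X))
      ([set v | exists (i : 'I_s) (j : 'I_k),
                  v = h i j *: delta (widen_ord sN i)] `|`
       [set v | exists2 i : 'I_N, (s <= i)%N & v = delta i]).
Proof.
move=> [Xinj Xdim] Xh Xgen.
have /fin_all_exists2[A Afull XA] i := vspace_equations (Xdim i).
have {}XA i : [set` X i] = kerset (A i).
  by apply/seteqP; split=> v /=; rewrite /kerset /= XA => /eqP.
have Asep i j : i != j -> exists2 w, kerset (A i) w & ~ kerset (A j) w.
  move=> ij; have: ~~ (X i <= X j)%VS.
    apply: contra ij => sub; apply/eqP/Xinj/eqP.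
    by rewrite eqEdim sub -(leq_add2r k) !Xdim /=.
  by move=> /subvPn[w Xw nXw]; exists w; rewrite -XA //=; apply/negP.
have unionA : arr_union X = \bigcup_(i in [set: 'I_s]) kerset (A i).
  by apply: eq_bigcupr => i _; exact: XA.
have Wfull := generic_minors_full sN Afull XA Xgen.
have [D Du DW] := pid_completion Wfull.
(* The columns of [pid_mx s] say that the first [s] coordinates in the frame are
   the contractions with the forms attached to the components. *)
have minorsE i d : contract (minors (A i)) d = frame_coord D (widen_ord sN i) d.
  rewrite {1}(frame_sum Du d) contract_sum (bigD1 (widen_ord sN i)) //=.
  have cE l : contract (minors (A i)) (frame D l) = (l == widen_ord sN i)%:R.
    rewrite contract_const.
    have /(congr1 (fun M : 'M_(N, s) => M l i)) := DW.
    rewrite !mxE => DWl; rewrite -val_eqE /=.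
    (* [pid_mx] also tests that the index is below [s]. *)
    have -> : (l == i :> nat) = (l == i :> nat) && (l < s)%N.
      by case: eqP => // ->; rewrite ltn_ord.
    rewrite -mpolyC_nat -DWl; congr (_%:MP); apply: eq_bigr => e _.
    by rewrite !mxE.
  rewrite big1 => [|l li]; first by rewrite contractZ cE eqxx mulr1 addr0.
  by rewrite contractZ cE (negPf li) mulr0.
have DerE d : Der_log k (arr_union X) d <->
    forall i : 'I_s, ideal_gen (range (h i)) (frame_coord D (widen_ord sN i) d).
  rewrite unionA Der_log_arrangement //.
  by split=> d0 i; have := d0 i; rewrite -Xh XA minorsE.
exists (frame D); split; first exact: frame_basis.
set G := (X in min_generating _ X).
have DerG : mspan G = Der_log k (arr_union X).
  apply/seteqP; split.
    apply: mspan_min => [|u v|a v|].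
    - by apply/DerE => i; rewrite /frame_coord contract0; exact: mspan0.
    - move=> /DerE Du' /DerE Dv; apply/DerE => i.
      by rewrite /frame_coord contractD; apply: ideal_genD.
    - move=> /DerE Dv; apply/DerE => i.
      by rewrite /frame_coord contractZ; apply: ideal_genM (Dv i).
    - move=> _ [[i [j ->]]|[i si ->]]; apply/DerE => l.
        rewrite /frame_coord contractZ -/(frame_coord D _ _) frame_coordE //.
        rewrite -val_eqE /= val_eqE; case: eqP => [->|_].
          by rewrite mulr1; apply: mspan_gen; exists j.
        by rewrite mulr0; apply: mspan0.
      rewrite frame_coordE // -val_eqE /=; case: eqP => [il|_]; last exact: mspan0.
      by move: si; rewrite il leqNgt ltn_ord.
  move=> d /DerE d0; rewrite (frame_sum Du d); apply: mspan_sum => i.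
  case: (ltnP i s) => [si|si]; last by apply/mspanZ/mspan_gen; right; exists i.
  have -> : i = widen_ord sN (Ordinal si) by apply: val_inj.
  have [m [c [g [hg ->]]]] := d0 (Ordinal si).
  rewrite scaler_suml; apply: mspan_sum => l; rewrite -scalerA; apply: mspanZ.
  by have [j _ <-] := hg l; apply: mspan_gen; left; exists (Ordinal si), j.
split=> // G' G'G G'D; apply/seteqP; split=> // v Gv; apply: boolp.contrapT => nG'v.
have coord_span l d : mspan G' d ->
    ideal_gen (frame_coord D l @` G') (frame_coord D l d).
  pose T := [set d | ideal_gen (frame_coord D l @` G') (frame_coord D l d)].
  apply: (@mspan_min _ _ _ T) => [|u w|a w|w G'w]; rewrite /T /=.
  - by rewrite /frame_coord contract0; exact: mspan0.
  - by move=> *; rewrite /frame_coord contractD; apply: ideal_genD.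
  - by move=> ?; rewrite /frame_coord contractZ; apply: ideal_genM.
  - by apply: mspan_gen; exists w.
(* If [v = h i j *: frame i] is omitted, the [i]-th coordinates of the remaining
   generators are zero or some [h i l] with [l != j]; they generate the ideal of
   [X i], since [f *: frame i] is logarithmic for all [f] in this ideal. *)
case: (Gv) => [[i [j defv]]|[i si defv]].
  apply: (@subspace_ideal_minimal (A i) (h i) j
            (frame_coord D (widen_ord sN i) @` G')) => //.
  - by move=> l; rewrite -XA Xh; apply: mspan_gen; exists l.
  - move=> _ [g G'g <-].
    case: (G'G _ G'g) => [[i' [j' defg]]|[i' si' defg]]; rewrite defg.
      rewrite /frame_coord contractZ -/(frame_coord D _ _) frame_coordE //.
      rewrite -val_eqE /= val_eqE; case: eqP => [i'i|_]; last by left; rewrite mulr0.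
      right; exists j'; last by rewrite mulr1 i'i.
      apply/eqP => j'j; apply: nG'v.
      by rewrite defv -i'i -j'j -defg.
    rewrite frame_coordE // -val_eqE /=; case: eqP => [il|_]; last by left.
    by move: si'; rewrite il leqNgt ltn_ord.
  move=> f; rewrite -XA => f0.
  have := @coord_span (widen_ord sN i) (f *: frame D (widen_ord sN i)).
  rewrite {2}/frame_coord contractZ -/(frame_coord D _ _) frame_coordE // eqxx mulr1.
  apply; rewrite G'D; apply/DerE => l.
  rewrite /frame_coord contractZ -/(frame_coord D _ _) frame_coordE //.
  rewrite -val_eqE /= val_eqE; case: eqP => [<-|_]; first by rewrite mulr1 -Xh.
  by rewrite mulr0; exact: mspan0.
(* If [v = frame i] with [s <= i] is omitted, the [i]-th coordinates of the
   remaining generators are all zero. *)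
have := @coord_span i v; rewrite G'D -DerG => /(_ (mspan_gen Gv)).
rewrite defv frame_coordE // eqxx => one_gen.
suff T1 : ideal_gen (frame_coord D i @` G') `<=` [set (0 : S^o)].
  by have /eqP := T1 _ one_gen; rewrite oner_eq0.
apply: (@mspan_min _ S^o _ [set 0]) => [//|u w|a w|_ [g G'g <-]] /=.
- by move=> -> ->; rewrite addr0.
- by move=> ->; rewrite scaler0.
case: (G'G _ G'g) => [[i' [j' ->]]|[i' si' defg]].
  rewrite /frame_coord contractZ -/(frame_coord D _ _) frame_coordE //.
  rewrite -val_eqE /=; case: eqP => [ii'|_]; last by rewrite mulr0.
  by move: si; rewrite -ii' leqNgt ltn_ord.
rewrite defg frame_coordE //; case: eqP => // ii'.
by case: nG'v; rewrite defv -ii' -defg.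
Qed.

End Main.

Theorem theorem3p8 (R : realType) (n k s : nat) (n_gt0 : (0 < n)%N)
    (X : 'I_s -> {vspace 'rV[R[i]]_n})
    (h : 'I_s -> 'I_k -> {mpoly R[i][n]})
    (X_arr : subspace_arrangement k X)
    (h_reg : forall i, regular_seq (h i))
    (X_def : forall i, vanishing_ideal [set` X i] = ideal_gen (range (h i)))
    (s_le : (s <= 'C(n, k))%N)
    (X_gen : generic k X) :
  exists delta : 'I_('C(n, k)) -> kvec R[i] n k,
    is_basis [set: kvec R[i] n k] delta /\
    min_generating (Der_log k (arr_union X))
      ([set v | exists (i : 'I_s) (j : 'I_k),
                  v = h i j *: delta (widen_ord s_le i)] `|`
       [set v | exists2 i : 'I_('C(n, k)), (s <= i)%N & v = delta i]).
Proof.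
exact: generic_arrangement_generators.
Qed.
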